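(* Let $A$ be a nilpotent group and let $B$ be a solvable group. Let $C_A$ be a proper subgroup of $A$, let $C_B$ be a proper subgroup of $B$, and let $\theta : C_A \to C_B$ be an isomorphism. Let $G = \{A \ast B \,;\, C_A = C_B\}$ be the generalized free product of $A$ and $B$ in which $C_A$ and $C_B$ are identified via $\theta$. Then $G$ is not perfect.
   Context: The generalized free product (amalgamated free product) $\{A \ast B \,;\, C_A = C_B\}$ is the quotient of the free product $A \ast B$ by the normal closure of the set $\{c\,\theta(c)^{-1} : c \in C_A\}$. A group is perfect if it equals its own commutator subgroup. No finite generation is assumed. *)

(* Defs.v *)
From HB Require Import structures.
From mathcomp Require Import all_boot.
From mathcomp Require Import boolp classical_sets.

Set Implicit Arguments.
Unset Strict Implicit.
Unset Printing Implicit Defensive.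

Local Open Scope classical_set_scope.
Local Open Scope group_scope.
Local Open Scope quotient_scope.

Section Subgroups.
Variable G : groupType.
Implicit Types (S H K : set G).

Definition is_subgroup H : Prop := group_closed (mem H).

Definition is_normal H : Prop :=
  is_subgroup H /\ (forall x y : G, H x -> H (x ^ y)).

Definition subgroup_generated S : set G := smallest is_subgroup S.

Definition normal_closure S : set G := smallest is_normal S.

Definition commutator H K : set G :=
  subgroup_generated [set [~ x, y] | x in H & y in K].

Fixpoint derived_series (n : nat) : set G :=
  if n is n'.+1 then commutator (derived_series n') (derived_series n')
  else [set: G].

(* gamma_{n+1} in the customary numbering that starts at gamma_1 = G. *)
Fixpoint lower_central_series (n : nat) : set G :=
  if n is n'.+1 then commutator (lower_central_series n') [set: G]
  else [set: G].

End Subgroups.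

Arguments derived_series G n : clear implicits.
Arguments lower_central_series G n : clear implicits.

Definition solvable_group (G : groupType) : Prop :=
  exists n : nat, derived_series G n = [set 1].

Definition nilpotent_group (G : groupType) : Prop :=
  exists n : nat, lower_central_series G n = [set 1].

Definition perfect_group (G : groupType) : Prop :=
  commutator [set: G] [set: G] = [set: G].

Section NormalClosureTheory.
Variables (G : groupType) (S : set G).
Local Notation N := (normal_closure S).

Lemma normal_closure_is_normal : is_normal N.
Proof.
split; first split.
- by rewrite inE => M [[[+ _] _] _]; rewrite inE.
- move=> x y; rewrite !inE => Nx Ny M MP.
  have [[[_ MF] _] _] := MP.
  by have := MF x y; rewrite !inE; apply; [apply: Nx|apply: Ny].
- move=> x y Nx M MP; have [[_ MJ] _] := MP.
  exact/MJ/(Nx M MP).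
Qed.

Lemma normal_closure1 : N 1.
Proof. by have [[+ _] _] := normal_closure_is_normal; rewrite inE. Qed.

Lemma normal_closureF x y : N x -> N y -> N (x / y).
Proof.
have [[_ NF] _] := normal_closure_is_normal.
by have := NF x y; rewrite !inE.
Qed.

Lemma normal_closureV x : N x -> N x^-1.
Proof. by move=> /(normal_closureF normal_closure1); rewrite div1g. Qed.

Lemma normal_closureM x y : N x -> N y -> N (x * y).
Proof. by move=> Nx /normal_closureV/(normal_closureF Nx); rewrite invgK. Qed.

Lemma normal_closureJ x y : N x -> N (x ^ y).
Proof. by have [_ NJ] := normal_closure_is_normal; apply: NJ. Qed.

End NormalClosureTheory.

Section Quotient.
Variables (G : groupType) (S : set G).
Local Notation N := (normal_closure S).

Definition same_coset (x y : G) : bool := `[< N (x^-1 * y) >].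

Lemma same_coset_refl : reflexive same_coset.
Proof. by move=> x; apply/asboolP; rewrite mulVg; apply: normal_closure1. Qed.

Lemma same_coset_sym : symmetric same_coset.
Proof.
move=> x y; apply/asboolP/asboolP => /normal_closureV;
  by rewrite invgM invgK.
Qed.

Lemma same_coset_trans : transitive same_coset.
Proof.
move=> y x z /asboolP xy /asboolP yz; apply/asboolP.
by have := normal_closureM xy yz; rewrite -mulgA mulVKg.
Qed.

Canonical same_coset_equiv :=
  EquivRel same_coset same_coset_refl same_coset_sym same_coset_trans.

(* S is an arbitrary subset: the quotient is by its normal closure. *)
Definition quotient_group := {eq_quot same_coset}.
HB.instance Definition _ := EqQuotient.on quotient_group.
HB.instance Definition _ := Choice.on quotient_group.

Definition quotient_proj (x : G) : quotient_group := \pi x.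

Lemma quotient_projP x y :
  reflect (quotient_proj x = quotient_proj y) (same_coset x y).
Proof. exact: (iffP (eqmodP _ _ _)). Qed.

Let one : quotient_group := quotient_proj 1.
Let inv (u : quotient_group) := quotient_proj (repr u)^-1.
Let mul (u v : quotient_group) := quotient_proj (repr u * repr v).

Let projK u : quotient_proj (repr u) = u. Proof. exact: reprK. Qed.

Let projV x : inv (quotient_proj x) = quotient_proj x^-1.
Proof.
apply/quotient_projP/asboolP; rewrite invgK.
have /quotient_projP/asboolP/normal_closureV := projK (quotient_proj x).
by move=> /normal_closureJ-/(_ x^-1); rewrite /conjg !invgM !invgK mulgA mulVKg.
Qed.

Let projM x y : mul (quotient_proj x) (quotient_proj y) = quotient_proj (x * y).
Proof.
apply/quotient_projP/asboolP.
have /quotient_projP/asboolP := projK (quotient_proj x).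
have /quotient_projP/asboolP := projK (quotient_proj y).
move: (repr _) (repr _) => x' y' Ny /normal_closureJ-/(_ y') Nx.
have := normal_closureM Nx Ny.
by rewrite /conjg invgM -!mulgA mulVKg.
Qed.

Let mulA : associative mul.
Proof.
by move=> u v w; rewrite -(projK u) -(projK v) -(projK w) !projM mulgA.
Qed.
Let mul1 : left_id one mul.
Proof. by move=> u; rewrite -(projK u) projM mul1g. Qed.
Let mulr1 : right_id one mul.
Proof. by move=> u; rewrite -(projK u) projM mulg1. Qed.
Let mulV : left_inverse one inv mul.
Proof. by move=> u; rewrite -(projK u) projV projM mulVg. Qed.
Let mulrV : right_inverse one inv mul.
Proof. by move=> u; rewrite -(projK u) projV projM mulgV. Qed.

HB.instance Definition _ := isGroup.Build quotient_group mulA mul1 mulr1 mulV mulrV.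

Lemma quotient_projM : {morph quotient_proj : x y / x * y}.
Proof. by move=> x y; rewrite -projM. Qed.

HB.instance Definition _ :=
  isMultiplicative.Build G quotient_group quotient_proj quotient_projM.

End Quotient.

Section FreeProduct.
Variables A B : groupType.

Definition word := seq (A + B).

(* The least congruence for concatenation that makes both inclusions of
   letters multiplicative and unital. *)
Inductive word_eqv : word -> word -> Prop :=
| word_eqv_refl u : word_eqv u u
| word_eqv_sym u v : word_eqv u v -> word_eqv v u
| word_eqv_trans v u w : word_eqv u v -> word_eqv v w -> word_eqv u w
| word_eqv_cat u u' v v' :
    word_eqv u u' -> word_eqv v v' -> word_eqv (u ++ v) (u' ++ v')
| word_eqv_onel : word_eqv [:: inl 1] [::]
| word_eqv_oner : word_eqv [:: inr 1] [::]
| word_eqv_mull (a a' : A) : word_eqv [:: inl a; inl a'] [:: inl (a * a')]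
| word_eqv_mulr (b b' : B) : word_eqv [:: inr b; inr b'] [:: inr (b * b')].

Definition same_element (u v : word) : bool := `[< word_eqv u v >].

Lemma same_element_refl : reflexive same_element.
Proof. by move=> u; apply/asboolP; constructor. Qed.

Lemma same_element_sym : symmetric same_element.
Proof. by move=> u v; apply/asboolP/asboolP => ?; apply: word_eqv_sym. Qed.

Lemma same_element_trans : transitive same_element.
Proof.
by move=> v u w /asboolP uv /asboolP vw; apply/asboolP/(word_eqv_trans uv).
Qed.

Canonical same_element_equiv :=
  EquivRel same_element same_element_refl same_element_sym same_element_trans.

Definition free_product := {eq_quot same_element}.
HB.instance Definition _ := EqQuotient.on free_product.
HB.instance Definition _ := Choice.on free_product.

Definition free_product_of_word (w : word) : free_product := \pi w.
Local Notation cl := free_product_of_word.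

Lemma free_product_of_wordP u v : cl u = cl v <-> word_eqv u v.
Proof.
split=> [/eqmodP/asboolP //|uv]; exact/eqmodP/asboolP.
Qed.

Definition letter_inv (x : A + B) : A + B :=
  match x with inl a => inl a^-1 | inr b => inr b^-1 end.

Definition word_inv (w : word) : word := rev (map letter_inv w).

Let letterVl x : word_eqv [:: letter_inv x; x] [::].
Proof.
case: x => [a|b] /=.
- by apply: word_eqv_trans (word_eqv_mull _ _) _; rewrite mulVg; constructor.
- by apply: word_eqv_trans (word_eqv_mulr _ _) _; rewrite mulVg; constructor.
Qed.

Let letterVr x : word_eqv [:: x; letter_inv x] [::].
Proof.
case: x => [a|b] /=.
- by apply: word_eqv_trans (word_eqv_mull _ _) _; rewrite mulgV; constructor.
- by apply: word_eqv_trans (word_eqv_mulr _ _) _; rewrite mulgV; constructor.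
Qed.

Let eqv_mid p q m : word_eqv m [::] -> word_eqv (p ++ m ++ q) (p ++ q).
Proof.
move=> m0; apply: word_eqv_cat; first exact: word_eqv_refl.
by apply: (@word_eqv_cat m [::] q q) => //; apply: word_eqv_refl.
Qed.

Let wordVl w : word_eqv (word_inv w ++ w) [::].
Proof.
elim: w => [|x w IH]; first exact: word_eqv_refl.
rewrite /word_inv /= rev_cons cat_rcons.
apply: word_eqv_trans IH.
exact: (eqv_mid (word_inv w) w (letterVl x)).
Qed.

Let wordVr w : word_eqv (w ++ word_inv w) [::].
Proof.
elim: w => [|x w IH]; first exact: word_eqv_refl.
rewrite /word_inv /= rev_cons -cats1 catA.
apply: word_eqv_trans (letterVr x).
exact: (@eqv_mid [:: x] [:: letter_inv x] _ IH).
Qed.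

Let one : free_product := cl [::].
Let inv (u : free_product) := cl (word_inv (repr u)).
Let mul (u v : free_product) := cl (repr u ++ repr v).

Let clK u : cl (repr u) = u. Proof. exact: reprK. Qed.

Let clM u v : mul (cl u) (cl v) = cl (u ++ v).
Proof. by apply/free_product_of_wordP/word_eqv_cat; apply/free_product_of_wordP. Qed.

Let mulA : associative mul.
Proof. by move=> u v w; rewrite -(clK u) -(clK v) -(clK w) !clM catA. Qed.
Let mul1 : left_id one mul.
Proof. by move=> u; rewrite -(clK u) clM. Qed.
Let mulr1 : right_id one mul.
Proof. by move=> u; rewrite -(clK u) clM cats0. Qed.
Let mulV : left_inverse one inv mul.
Proof.
by move=> u; rewrite -{2}(clK u) clM; apply/free_product_of_wordP/wordVl.
Qed.
Let mulrV : right_inverse one inv mul.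
Proof.
by move=> u; rewrite -{1}(clK u) clM; apply/free_product_of_wordP/wordVr.
Qed.

HB.instance Definition _ := isGroup.Build free_product mulA mul1 mulr1 mulV mulrV.

Definition free_product_inl (a : A) : free_product := cl [:: inl a].
Definition free_product_inr (b : B) : free_product := cl [:: inr b].

Lemma free_product_inlM : {morph free_product_inl : x y / x * y}.
Proof.
move=> x y; rewrite [RHS]clM.
by apply/free_product_of_wordP/word_eqv_sym/word_eqv_mull.
Qed.

Lemma free_product_inrM : {morph free_product_inr : x y / x * y}.
Proof.
move=> x y; rewrite [RHS]clM.
by apply/free_product_of_wordP/word_eqv_sym/word_eqv_mulr.
Qed.

HB.instance Definition _ :=
  isMultiplicative.Build A free_product free_product_inl free_product_inlM.
HB.instance Definition _ :=
  isMultiplicative.Build B free_product free_product_inr free_product_inrM.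

End FreeProduct.

(* A subgroup is a boolean predicate together with its subtype, seen as a group
   in its own right; by excluded middle every subgroup has this form. *)
Section Amalgam.
Variables (A B : groupType) (SA : pred A) (SB : pred B).
Variables (CA : subGroupType SA) (CB : subGroupType SB).
Variable theta : CA -> CB.

Definition amalgam_relators : set (free_product A B) :=
  [set free_product_inl B (val c) * (free_product_inr A (val (theta c)))^-1
  | c in [set: CA]].

Definition amalgam : groupType := quotient_group amalgam_relators.

End Amalgam.

(* Main.v *)
(* Killing B in the amalgam leaves A modulo the normal closure of C_A.  In a
   nilpotent group a proper subgroup C lies in a proper normal subgroup with
   abelian quotient: if i is the last index with C * gamma_i = A, then
   C * gamma_(i+1) is such a subgroup, because gamma_i is central modulo
   gamma_(i+1).  So G maps onto a nontrivial abelian quotient of A. *)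

Require Import Defs.
From HB Require Import structures.
From mathcomp Require Import all_boot.
From mathcomp Require Import boolp classical_sets.

Set Implicit Arguments.
Unset Strict Implicit.
Unset Printing Implicit Defensive.

Local Open Scope classical_set_scope.
Local Open Scope group_scope.

Section SubgroupTheory.
Variable G : groupType.
Implicit Types (H K S : set G) (x y : G).

Lemma is_subgroupP H :
  is_subgroup H <-> H 1 /\ (forall x y, H x -> H y -> H (x / y)).
Proof.
split=> -[H1 HF]; split; first by rewrite inE in H1.
- by move=> x y Hx Hy; have := HF x y; rewrite !inE; apply.
- by rewrite inE.
- by move=> x y; rewrite !inE; apply: HF.
Qed.

Lemma subgroup1 H : is_subgroup H -> H 1.
Proof. by case/is_subgroupP. Qed.

Lemma subgroupF H x y : is_subgroup H -> H x -> H y -> H (x / y).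
Proof. by case/is_subgroupP=> _; apply. Qed.

Lemma subgroupV H x : is_subgroup H -> H x -> H x^-1.
Proof. by move=> sH Hx; rewrite -div1g; apply: subgroupF => //; apply: subgroup1. Qed.

Lemma subgroupM H x y : is_subgroup H -> H x -> H y -> H (x * y).
Proof. by move=> sH Hx Hy; rewrite -[y]invgK; do 2?[apply: subgroupF|apply: subgroupV]. Qed.

Lemma subgroupR H x y : is_subgroup H -> H x -> H y -> H [~ x, y].
Proof.
move=> sH Hx Hy; rewrite /commg /conjg.
by do ![apply: subgroupM => //|apply: subgroupV => //].
Qed.

Lemma subgroupT : is_subgroup [set: G].
Proof. exact/is_subgroupP. Qed.

Lemma commutator_subgroup H K : is_subgroup (commutator H K).
Proof.
apply/is_subgroupP; split=> [M [sM _]|x y Hx Hy M MP]; first exact: subgroup1.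
by apply: subgroupF; [case: MP | apply: Hx | apply: Hy].
Qed.

Lemma mem_commutator H K x y : H x -> K y -> commutator H K [~ x, y].
Proof. by move=> Hx Ky M [_]; apply; exists x => //; exists y. Qed.

Lemma commutator_sub H K M : is_subgroup M ->
  (forall x y, H x -> K y -> M [~ x, y]) -> commutator H K `<=` M.
Proof. by move=> sM sub x; apply; split=> // _ [y Hy [z Kz <-]]; apply: sub. Qed.

(** Conjugation differs from the identity by a commutator: [x ^ y = x * [~ x, y]]. In particular a
    subgroup containing all commutators is normal. *)
Lemma is_normal_commutator_sub H :
  is_subgroup H -> (forall x y, H x -> H [~ x, y]) -> is_normal H.
Proof.
move=> sH HR; split=> // x y Hx.
by rewrite -[x ^ y](mulVKg x) -commgEl; apply: subgroupM => //; apply: HR.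
Qed.

Lemma lower_central_series_is_normal n : is_normal (lower_central_series G n).
Proof.
elim: n => [|n [sG nG]] /=; first by split=> //; apply: subgroupT.
apply: is_normal_commutator_sub => [|x y Hx]; first exact: commutator_subgroup.
(* It suffices that the series descends. A generator [[~ u, v] = u^-1 * u ^ v] of the next term lies
   in the current one, which is normal by induction. *)
apply: mem_commutator => //; apply: commutator_sub Hx => // u v Hu _.
by rewrite commgEl; apply: subgroupM => //; [apply: subgroupV | apply: nG].
Qed.

Lemma lower_central_series_subgroup n : is_subgroup (lower_central_series G n).
Proof. by case: (lower_central_series_is_normal n). Qed.

Lemma lower_central_series_commg n x y :
  lower_central_series G n x -> lower_central_series G n.+1 [~ x, y].
Proof. by move=> Hx; apply: mem_commutator. Qed.

Lemma normal_product_subgroup H K : is_subgroup H -> is_normal K ->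
  is_subgroup [set x * y | x in H & y in K].
Proof.
move=> sH [sK nK]; apply/is_subgroupP; split.
  exists 1; first exact: subgroup1.
  by exists 1; [exact: subgroup1 | rewrite mulg1].
move=> _ _ [h Hh [k Kk <-]] [h' Hh' [k' Kk' <-]].
(* Moving [h'^-1] to the left past [k / k'] conjugates the latter, and [K] is normal. *)
exists (h / h'); first exact: subgroupF.
exists ((k / k') ^ h'^-1); first by apply: nK; apply: subgroupF.
by rewrite /conjg invgK invgM !mulgA mulgVK.
Qed.

Lemma normal_closure_sub S H : is_normal H -> S `<=` H -> normal_closure S `<=` H.
Proof. by move=> nH SH x; apply. Qed.

End SubgroupTheory.

(** Normality of [N] is left out of the conclusion: it follows from the last clause. *)
Lemma nilpotent_proper_subgroup (A : groupType) (C : set A) :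
    nilpotent_group A -> is_subgroup C -> C <> [set: A] ->
  exists N : set A, [/\ is_subgroup N, C `<=` N, N <> [set: A]
                      & forall x y, N [~ x, y]].
Proof.
move=> [n gamma_n] sC properC.
pose CG i := [set c * g | c in C & g in lower_central_series A i].
have CG0 : CG 0 = [set: A].
  apply/seteqP; split=> // a _.
  by exists 1; [exact: subgroup1 | exists a; rewrite ?mul1g].
have CGn : CG n <> [set: A].
  move=> CGT; apply: properC; apply/seteqP; split=> // a _.
  have : CG n a by rewrite CGT.
  by case=> c Cc [g]; rewrite gamma_n => -> <-; rewrite mulg1.
(* Without such an index, induction would carry [CG 0 = [set: A]] up to [CG n]. *)
have [i CGi CGi1] : exists2 i, CG i = [set: A] & CG i.+1 <> [set: A].
  apply: contrapT => noi; apply: CGn; elim: n {gamma_n} => // i CGi.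
  by apply: contrapT => CGi1; apply: noi; exists i.
have sN : is_subgroup (CG i.+1).
  apply: normal_product_subgroup => //.
  exact: lower_central_series_is_normal.
have CN : C `<=` CG i.+1.
  move=> c Cc; exists c => //; exists 1; last by rewrite mulg1.
  by apply: subgroup1; apply: lower_central_series_subgroup.
have gN g : lower_central_series A i.+1 g -> CG i.+1 g.
  by move=> Hg; exists 1; [exact: subgroup1 | exists g; rewrite ?mul1g].
(* The [i]-th term normalizes [CG i.+1], because [u ^ g = u * [~ g, u]^-1] and [[~ g, u]] lies in
   the next term. *)
have NJ u g : CG i.+1 u -> lower_central_series A i g -> CG i.+1 (u ^ g).
  move=> Nu Hg; rewrite -[u ^ g](mulVKg u) -commgEl -invgR.
  apply: subgroupM => //; apply: subgroupV => //.
  by apply: gN; apply: lower_central_series_commg.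
exists (CG i.+1); split=> // x y.
(* Write [x = c * g] and [y = d * h] with [c], [d] in [C] and [g], [h] in the [i]-th term. Expanding
   the commutator leaves [[~ c, d]], which is in [C], and commutators involving [g] or [h], which
   are in the next term; the conjugations by [g] and [h] are absorbed by [NJ]. *)
have [c Cc [g Hg <-]] : CG i x by rewrite CGi.
have [d Cd [h Hh <-]] : CG i y by rewrite CGi.
have -> : [~ c * g, d * h] = [~ c, d * h] ^ g * [~ g, d * h].
  by rewrite /commg /conjg !invgM !mulgA !(mulgVK, mulgK).
apply: subgroupM => //; last by apply: (gN); apply: lower_central_series_commg.
apply: (NJ) => //.
have -> : [~ c, d * h] = [~ c, h] * [~ c, d] ^ h.
  by rewrite /commg /conjg !invgM !mulgA !(mulgVK, mulgK).
apply: subgroupM => //; last by apply: NJ => //; apply: CN; apply: subgroupR.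
rewrite -invgR; apply: subgroupV => //.
by apply: gN; apply: lower_central_series_commg.
Qed.

Lemma kernel_is_normal (G T : groupType) (f : UMagmaMorphism.type G T) :
  is_normal [set x | f x = 1].
Proof.
split=> [|x y /= fx]; last by rewrite gmulfJ fx conj1g.
apply/is_subgroupP; split=> /= [|x y fx fy]; first exact: gmulf1.
by rewrite gmulfF fx fy divg1.
Qed.

(** The kernel is a subgroup containing every commutator, hence the whole commutator subgroup. *)
Lemma perfect_group_abelian_image (G T : groupType)
    (f : UMagmaMorphism.type G T) :
  perfect_group G -> (forall x y : T, commute x y) -> forall x, f x = 1.
Proof.
move=> perfG abT x.
have : commutator [set: G] [set: G] x by rewrite perfG.
apply: (@commutator_sub _ _ _ [set x | f x = 1]) => [|u v _ _ /=].
  by case: (kernel_is_normal f).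
by rewrite gmulfR; apply/eqP/commgP/abT.
Qed.

HB.instance Definition _ (G : groupType) (S : set G) :=
  Multiplicative_isUMagmaMorphism.Build G (quotient_group S)
    (quotient_proj S) erefl.

(** The kernel of [f] is normal and contains [S], hence its normal closure, so evaluating [f] at a
    chosen representative does not depend on the choice. *)
Lemma quotient_group_lift (G T : groupType) (S : set G)
    (f : UMagmaMorphism.type G T) : (forall x, S x -> f x = 1) ->
  exists h : UMagmaMorphism.type (quotient_group S) T,
    forall x, h (quotient_proj S x) = f x.
Proof.
move=> fS.
have kerf : normal_closure S `<=` [set x | f x = 1].
  by apply: normal_closure_sub => //; apply: kernel_is_normal.
pose h (q : quotient_group S) := f (repr q).
have projK u : quotient_proj S (repr u) = u by exact: reprK.
have hE x : h (quotient_proj S x) = f x.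
  have /quotient_projP/asboolP/kerf /= := projK (quotient_proj S x).
  by rewrite gmulfM gmulfV => /mulg1_eq; rewrite invgK.
have hM : {morph h : u v / u * v}.
  by move=> u v; rewrite -(projK u) -(projK v) -gmulfM !hE gmulfM.
have h1 : h 1 = 1 by apply: (mulgI (h 1)); rewrite -hM !mulg1.
by exists (HB.pack_for (UMagmaMorphism.type _ _) h
  (isUMagmaMorphism.Build _ _ h (h1, hM))).
Qed.

(** Universal property: multiplying out the images of the letters respects each rule generating
    [word_eqv], since [f] and [g] are unital and multiplicative. *)
Lemma free_product_lift (A B T : groupType)
    (f : UMagmaMorphism.type A T) (g : UMagmaMorphism.type B T) :
  exists h : UMagmaMorphism.type (free_product A B) T,
    (forall a, h (free_product_inl B a) = f a) /\
    (forall b, h (free_product_inr A b) = g b).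
Proof.
pose letter x := match x with inl a => f a | inr b => g b end.
pose eval (w : word A B) := \prod_(x <- w) letter x.
have eval_eqv u v : word_eqv u v -> eval u = eval v.
  elim=> {u v} [//|//|u v w _ -> //|u u' v v' _ uu' _ vv'||||] *;
    rewrite /eval ?big_cat ?big_cons ?big_nil ?mulg1 /= ?gmulf1 ?gmulfM //.
  by congr (_ * _).
pose h (u : free_product A B) := eval (repr u).
have hE w : h (free_product_of_word w) = eval w.
  by apply/eval_eqv/free_product_of_wordP; exact: reprK.
have hM : {morph h : u v / u * v}.
  by move=> u v; rewrite [LHS]hE /eval big_cat.
have h1 : h 1 = 1 by apply: (mulgI (h 1)); rewrite -hM !mulg1.
exists (HB.pack_for (UMagmaMorphism.type _ _) h
  (isUMagmaMorphism.Build _ _ h (h1, hM))).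
by split=> x /=; rewrite hE /eval big_seq1.
Qed.

Theorem theorem1 (A B : groupType)
    (hA : nilpotent_group A) (hB : solvable_group B)
    (SA : pred A) (CA : subGroupType SA)
    (SB : pred B) (CB : subGroupType SB)
    (properA : exists a : A, a \notin SA)
    (properB : exists b : B, b \notin SB)
    (theta : {multiplicative CA -> CB}) (iso_theta : bijective theta) :
  ~ perfect_group (amalgam theta).
Proof.
move=> perfG.
have sSA : is_subgroup [set a | SA a].
  apply/is_subgroupP; split=> [|x y /= Sx Sy].
    by rewrite /= -(@val1 _ _ CA); exact: valP.
  by rewrite -(SubK CA Sx) -(SubK CA Sy) -gmulfF; exact: valP.
have [|N [sN SN properN NR]] := nilpotent_proper_subgroup hA sSA.
  have [a /negP Sa] := properA; move=> SAT; apply: Sa.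
  by have : [set a | SA a] a by rewrite SAT.
have nN : is_normal N by apply: is_normal_commutator_sub.
(* [quotient_group N] divides by the normal closure of [N], which is [N] itself by [nN]. *)
have projE a : quotient_proj N a = 1 <-> N a.
  split=> [/esym/quotient_projP/asboolP | Na].
    by rewrite invg1 mul1g; apply: normal_closure_sub.
  apply/esym/quotient_projP/asboolP.
  by rewrite invg1 mul1g => M [_]; apply.
have abT (u v : quotient_group N) : commute u v.
  rewrite (_ : u = quotient_proj N (repr u)); last exact/esym/reprK.
  rewrite (_ : v = quotient_proj N (repr v)); last exact/esym/reprK.
  by apply/commgP/eqP; rewrite -gmulfR; apply/projE/NR.
have [f [fl fr]] := free_product_lift (quotient_proj N) (@one_fun B (quotient_group N)).
have [|h hE] := @quotient_group_lift _ _ (amalgam_relators theta) f.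
  (* As [B] maps to 1, a relator maps to the class of [val c], which is trivial because [val c] lies
     in [SA], hence in [N]. *)
  move=> _ [c _ <-]; rewrite gmulfM gmulfV fl fr invg1 mulg1.
  exact/projE/SN/valP.
(* Perfectness makes [h] trivial, so every [a] has trivial class and [N] would be all of [A]. *)
apply: properN; apply/seteqP; split=> // a _; apply/projE.
by rewrite -fl -hE; apply: perfect_group_abelian_image.
Qed.
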